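(* Let $\Delta_1 = \{\Delta_t^{\bar x} : \bar x \in X^{t^c}, t \in \mathbb{Z}^d\}$ be a one-point transition energy field satisfying the following condition: for any $\Lambda \in W$, any distinct $t,s \in \Lambda$ and any $I \subset \Lambda \setminus \{t,s\}$, $$\Delta_t^{zy}(x, \theta_t) - \Delta_t^{zv}(x, \theta_t) = \Delta_t^y(x, \theta_t) - \Delta_t^v(x, \theta_t), \qquad x \in X^t,\ y,v \in X^s,\ z \in X^I .$$ Then for any $\Lambda \in W$ the finite-volume correlation function $\rho_\Lambda$ of $\Delta_1$ satisfies the following equation: for any $I \subset \Lambda$, any $t \in I$, and any $x \in X_*^t$, $u \in X_*^{I \setminus t}$, $$\rho_\Lambda (xu) = \dfrac{e^{\Delta_t^u(x,\theta_t)}}{\sum_{\alpha \in X^t} e^{\Delta_t^u(\alpha,\theta_t)}} \left( \rho_\Lambda (u) + \sum_{\alpha \in X^t} e^{\Delta_t^u(\alpha,\theta_t)} \Big( G_\Lambda(xu) - G_\Lambda (\alpha u) \Big) \right),$$ where, for $x \in X^t$ (including $x=\theta_t$), $$G_\Lambda(xu) = \sum_{J \subset \Lambda \setminus I} \ \sum_{y \in X_*^J} K_{t \cup J}(xy) \left( \rho_\Lambda(uy) - \sum_{\alpha \in X_*^t} \rho_\Lambda(\alpha uy) \right)$$ and $$K_{t \cup J}(xy) = \prod_{s \in J} \left( e^{\Delta_s^x(y_s,\theta_s) - \Delta_s(y_s,\theta_s)} - 1\right).$$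
   Context: **Lattice and configurations.** $\mathbb{Z}^d$, $d\ge 1$, is the integer lattice. $W$ is the set of all nonempty finite subsets of $\mathbb{Z}^d$. $S^c$ is the complement of $S$ in $\mathbb{Z}^d$. Braces are omitted for one-point sets ($t^c=\{t\}^c$, $I\setminus t = I \setminus\{t\}$, $t\cup J=\{t\}\cup J$). $X$ is a finite set with $1<|X|<\infty$, and each $X^t$, $t\in\mathbb{Z}^d$, is a copy of $X$. For $S\subset\mathbb{Z}^d$, $X^S$ is the set of configurations $x=(x_t,t\in S)$, $x_t\in X^t$; $X^{\emptyset}$ consists of the single empty configuration $\boldsymbol{\emptyset}$. For disjoint $S,T$ and $x\in X^S$, $y\in X^T$, the concatenation $xy\in X^{S\cup T}$ equals $x$ on $S$ and $y$ on $T$. $x_T$ is the restriction of $x$ to $T$. A fixed element $\theta_t\in X^t$ (vacuum) is chosen for each $t$; $\theta=(\theta_t,t\in\mathbb{Z}^d)$ and $\theta_S$ is its restriction to $S$. $X_*^t=X^t\setminus\{\theta_t\}$, and $X_*^S$ is the set of configurations on $S$ none of whose components is the vacuum ($X_*^{\emptyset}=\{\boldsymbol{\emptyset}\}$). $L_*=\bigcup_{J\in W}X_*^J$. **One-point transition energy field.** A set $\Delta_1=\{\Delta_t^{\bar x}:\bar x\in X^{t^c},t\in\mathbb{Z}^d\}$ of real functions $\Delta_t^{\bar x}(x,u)$, $x,u\in X^t$, such that for all $t$ and $\bar x\in X^{t^c}$ $$\Delta_t^{\bar x}(x,u)=\Delta_t^{\bar x}(x,y)+\Delta_t^{\bar x}(y,u),\qquad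 x,u,y\in X^t,$$ and for all distinct $t,s\in\mathbb{Z}^d$ and $\bar x\in X^{\{t,s\}^c}$ $$\Delta_t^{\bar x y}(x,u)+\Delta_s^{\bar x u}(y,v)=\Delta_s^{\bar x x}(y,v)+\Delta_t^{\bar x v}(x,u),\qquad x,u\in X^t,\ y,v\in X^s.$$ **Corresponding transition energy field.** For $\Lambda\in W$, $\bar x\in X^{\Lambda^c}$ and $x,u\in X^\Lambda$, with any enumeration $\Lambda=\{t_1,\dots,t_n\}$, $$\Delta_\Lambda^{\bar x}(x,u)=\sum_{j=1}^n\Delta_{t_j}^{\bar x\,u_{\{t_1,\dots,t_{j-1}\}}\,x_{\{t_{j+1},\dots,t_n\}}}(x_{t_j},u_{t_j});$$ the value does not depend on the enumeration. **Vacuum boundary notation.** $\Delta_\Lambda=\Delta_\Lambda^{\theta_{\Lambda^c}}$. For $t\in\mathbb{Z}^d$, finite $I\subset t^c$ and $z\in X^I$, $\Delta_t^z$ stands for $\Delta_t^{z\theta_{(t\cup I)^c}}$; when $I=\emptyset$ this is $\Delta_t=\Delta_t^{\theta_{t^c}}$. **Finite-volume correlation function.** For $\Lambda\in W$, $\rho_\Lambda$ is the function on $L_*$ given by $$\rho_\Lambda(x)=Z_\Lambda^{-1}\sum_{y\in X^{\Lambda\setminus I}}\exp\{\Delta_\Lambda(xy,\theta_\Lambda)\}\quad\text{if }x\in X_*^I,\ I\subset\Lambda,$$ and $\rho_\Lambda(x)=0$ if $x\in X_*^I$, $I\not\subset\Lambda$, where $Z_\Lambda=\sum_{x\in X^\Lambda}\exp\{\Delta_\Lambda(x,\theta_\Lambda)\}$;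 moreover $\rho_\Lambda(\boldsymbol{\emptyset})=1$. Sums over $J\subset\Lambda\setminus I$ include $J=\emptyset$, and an empty product equals $1$. *)

(* Defs.v *)
From HB Require Import structures.
From mathcomp Require Import all_boot all_order all_algebra.
From mathcomp Require Import finmap.
From mathcomp Require Import reals sequences exp.

Set Implicit Arguments.
Unset Strict Implicit.
Unset Printing Implicit Defensive.

Import Order.TTheory GRing.Theory Num.Theory.
Local Open Scope fset_scope.
Local Open Scope fmap_scope.
Local Open Scope ring_scope.

Notation lattice d := 'rV[int]_d.

(* Two representations of configurations are used.  A configuration on a
   finite set J is a [y : {ffun J -> X}], or the finite map [FinMap y], whose
   domain is J; concatenation of disjoint finite maps is [catf].  A
   configuration on an infinite set S is a partial function with domain S. *)
Definition pconfig (d : nat) (X : Type) := lattice d -> option X.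

Section Configurations.
Variables (d : nat) (X : finType).
Implicit Types (t s : lattice d) (J S : {fset lattice d}).

(* xbar \in X^{S^c} *)
Definition config_off S (xbar : pconfig d X) : Prop :=
  forall s, isSome (xbar s) = (s \notin S).

(* The concatenation of xbar with z; only used when the domains are disjoint. *)
Definition concat (xbar : pconfig d X) (z : {fmap lattice d -> X}) :
    pconfig d X :=
  fun s => if z.[? s] is Some a then Some a else xbar s.

Definition site t (a : X) : {fmap lattice d -> X} := [fmap].[t <- a].

(* theta_{S^c} *)
Definition vacuum_off (theta : lattice d -> X) S : pconfig d X :=
  fun s => if s \in S then None else Some (theta s).

(* y \in X_*^J *)
Definition nonvacuum (theta : lattice d -> X) J (y : {ffun J -> X}) : bool :=
  [forall s : J, y s != theta (val s)].

(* The restriction of z to S; the default is not reached if S \subset domf z. *)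
Definition restr (theta : lattice d -> X) S (z : {fmap lattice d -> X}) :
    {ffun S -> X} :=
  [ffun s : S => odflt (theta (val s)) z.[? val s]].

End Configurations.

Section TransitionEnergy.
Variables (R : realType) (d : nat) (X : finType).

(* [delta t xbar x u] is Delta_t^{xbar}(x,u); it is meaningful, and only used,
   for xbar with domain t^c. *)
Definition one_point_energies := lattice d -> pconfig d X -> X -> X -> R.

Definition is_one_point_field (delta : one_point_energies) : Prop :=
  (forall (t : lattice d) (xbar : pconfig d X), config_off [fset t] xbar ->
     forall x u y : X,
       delta t xbar x u = delta t xbar x y + delta t xbar y u)
  /\
  (forall (t s : lattice d), t != s ->
     forall xbar : pconfig d X, config_off [fset t; s] xbar ->
     forall x u y v : X,
       delta t (concat xbar (site s y)) x u
         + delta s (concat xbar (site t u)) y v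
       = delta s (concat xbar (site t x)) y v
         + delta t (concat xbar (site s v)) x u).

Variables (theta : lattice d -> X) (delta : one_point_energies).

(* Delta_Lam^{xbar}(x,u).  The value is independent of the enumeration
   t_1, ..., t_n of Lam; the one given by [enum_rank] is used. *)
Definition field_energy (Lam : {fset lattice d}) (xbar : pconfig d X)
    (x u : {ffun Lam -> X}) : R :=
  \sum_(t : Lam)
    delta (val t)
      (concat xbar
         ((FinMap u).[& [fset val s | s : Lam & (enum_rank s < enum_rank t)%N]]
          + (FinMap x).[& [fset val s | s : Lam
                                      & (enum_rank t < enum_rank s)%N]])%fset)
      (x t) (u t).

(* Delta_Lam(x, theta_Lam), with vacuum boundary condition *)
Definition vac_field_energy (Lam : {fset lattice d}) (x : {ffun Lam -> X}) : R :=
  field_energy (vacuum_off theta Lam) x [ffun s : Lam => theta (val s)].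

(* Delta_t^z(x,u) for a finite configuration z on a subset of t^c *)
Definition vac_delta (t : lattice d) (z : {fmap lattice d -> X}) (x u : X) : R :=
  delta t (concat (vacuum_off theta (t |` domf z)) z) x u.

Definition partition_function (Lam : {fset lattice d}) : R :=
  \sum_(x : {ffun Lam -> X}) expR (vac_field_energy x).

(* rho_Lam; only its values on L_* and at the empty configuration are used. *)
Definition rho (Lam : {fset lattice d}) (x : {fmap lattice d -> X}) : R :=
  if domf x == fset0 then 1
  else if domf x `<=` Lam then
    (partition_function Lam)^-1 *
    \sum_(y : {ffun (Lam `\` domf x) -> X})
      expR (vac_field_energy (restr theta Lam (x + FinMap y)%fset))
  else 0.

(* K_{t \cup J}(xy), x being the component at t *)
Definition Kfun (t : lattice d) (J : {fset lattice d}) (x : X)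
    (y : {ffun J -> X}) : R :=
  \prod_(s : J)
    (expR (vac_delta (val s) (site t x) (y s) (theta (val s))
           - vac_delta (val s) [fmap] (y s) (theta (val s))) - 1).

(* G_Lam(xu), x being the component at t and u a configuration on I \ t *)
Definition Gfun (Lam I : {fset lattice d}) (t : lattice d) (x : X)
    (u : {fmap lattice d -> X}) : R :=
  \sum_(J <- fpowerset (Lam `\` I))
    \sum_(y : {ffun J -> X} | nonvacuum theta y)
      Kfun t x y *
      (rho Lam (u + FinMap y)%fset
       - \sum_(alpha : X | alpha != theta t)
           rho Lam (site t alpha + u + FinMap y)%fset).

End TransitionEnergy.

(* Main.v *)
Require Import Defs.
From HB Require Import structures.
From mathcomp Require Import all_boot all_order all_algebra.
From mathcomp Require Import finmap.
From mathcomp Require Import boolp reals sequences exp.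
From mathcomp Require Import lra.

Set Implicit Arguments.
Unset Strict Implicit.
Unset Printing Implicit Defensive.

Import Order.TTheory GRing.Theory Num.Theory.
Local Open Scope fset_scope.
Local Open Scope fmap_scope.
Local Open Scope ring_scope.

(** The energy of a configuration [f] on [Lam], with vacuum outside, satisfies
    [energy f = flip t f (f t) b + energy (upd f t b)]: the exchange identity
    makes the sum defining the energy independent of the order of the sites,
    so [t] may be treated as the first one ([relax_diff], [energy_diff]).
    Hence the Gibbs weight of a configuration with [alpha] at [t] is the weight
    of the one with the vacuum at [t] times the exponential of
    [flip t f alpha (theta t)].

    The hypothesis of the theorem says that the dependence of this exponent on
    the other sites is additive ([flip_two_site]).  Clearing the sites of
    [Lam] outside [I] one at a time ([flip_clear]) splits it into the same
    quantity for the boundary condition [u] and a sum of pair terms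
    [coupling t alpha s (f s)].  By the exchange identity the pair terms are
    symmetric in the two sites ([couplingC]), so the factors of [Kfun] are
    [expR (coupling ...) - 1], and the expansion of a product of terms
    [1 + (expR (coupling ...) - 1)] over subsets J is the sum over J and y in
    [Gfun] ([sum_Kfun]); the sites carrying the vacuum contribute 0 to it.

    On the other side, [rho (u y) - \sum_(alpha != theta t) rho (alpha u y)]
    is the normalised weight of the configurations that extend [u y] and carry
    the vacuum at [t] ([rho_vacuum_at]).  Altogether, for every [alpha],
    including the vacuum, the normalised weight of the configurations that
    extend [u] and carry [alpha] at [t] is [E alpha * G alpha]
    ([weight_Gfun]).  Summing over [alpha] gives
    [rho u = \sum_alpha E alpha * G alpha], and the right-hand side of the
    equation collapses to [E x * G x] ([weighted_mean_correction]). *)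

(** * Algebraic identities *)

Lemma sum_fpowerset_prod (R : comPzRingType) (K : choiceType) (S : {fset K})
    (g : K -> R) :
  \sum_(J <- fpowerset S) \prod_(s <- J) g s = \prod_(s <- S) (g s + 1).
Proof.
elim/fset1U_rect: S => [|a S aS IH].
  by rewrite fpowerset0 big_seq_fset1 !big_seq_fset0.
rewrite big_fsetU1 // -IH (big_fsetID _ (fun J : {fset K} => a \in J)) /=.
rewrite mulrDl mul1r mulr_sumr; congr (_ + _); last first.
  apply: eq_fbigl => J; rewrite !inE /= !fpowersetE andbC.
  apply/andP/idP => [[aJ JS]|JS].
    by rewrite -(fsetU1K aS) fsubsetD1 JS.
  split; first by apply: contra aS; exact: (fsubsetP JS).
  exact: (fsubset_trans JS (fsubsetUr _ _)).
transitivity (\sum_(J <- [fset a |` J | J in fpowerset S]) \prod_(s <- J) g s).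
  apply: eq_fbigl => J; rewrite !inE /= fpowersetE.
  apply/andP/imfsetP => /= [[JS aJ]|[J' J'S ->]].
    exists (J `\ a); last by rewrite fsetD1K.
    by rewrite fpowersetE fsubDset.
  by rewrite fset1U1 fsetUS // -fpowersetE.
have aF J : J \in fpowerset S -> a \notin J.
  by rewrite fpowersetE => JS; apply: contra aS; exact: (fsubsetP JS).
rewrite big_imfset /=; last first.
  by move=> J J' /aF aJ /aF aJ' e; rewrite -(fsetU1K aJ) e fsetU1K.
by apply: eq_fbigr => J /aF aJ _; rewrite big_fsetU1.
Qed.

(** The two sums add up to [(\sum_a E a) * G x]: the second replaces each
    [G a] of the first by [G x]. *)
Lemma weighted_mean_correction (R : fieldType) (X : finType) (E G : X -> R)
    (x : X) : \sum_(a : X) E a != 0 ->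
  E x / (\sum_(a : X) E a)
    * (\sum_(a : X) E a * G a + \sum_(a : X) E a * (G x - G a))
  = E x * G x.
Proof.
move=> E0; under [X in _ + X]eq_bigr => a _ do rewrite mulrBr.
by rewrite sumrB addrC subrK -mulr_suml mulrA divfK.
Qed.

(** * Configurations as total functions *)

Section Configurations.
Variables (d : nat) (X : finType) (theta : lattice d -> X).
Implicit Types (J S : {fset lattice d}) (f : lattice d -> X).
Implicit Types (t s : lattice d) (z : {fmap lattice d -> X}).

Definition upd f t (a : X) : lattice d -> X := fun s => if s == t then a else f s.

(** All the energies involved are evaluated at the restriction to the
    complement of [t] of a total function; working with total functions avoids
    domain conditions. *)
Definition off t f : pconfig d X := fun s => if s == t then None else Some (f s).

Definition fill z : lattice d -> X := fun s => odflt (theta s) z.[? s].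

Definition trace (J : {fset lattice d}) f : {ffun J -> X} :=
  [ffun s : J => f (val s)].

Definition vacuous_off (S : {fset lattice d}) f :=
  forall s, s \notin S -> f s = theta s.

(** Membership in the cylinder of configurations that extend [z]. *)
Definition agree z f : bool := [forall s : domf z, f (val s) == z s].

Lemma upd_off t a f : off t (upd f t a) = off t f.
Proof. by apply/funext => s; rewrite /off /upd; case: eqP. Qed.

Lemma upd_id t f : upd f t (f t) = f.
Proof. by apply/funext => s; rewrite /upd; case: eqP => // ->. Qed.

Lemma updC t s a b f : t != s -> upd (upd f t a) s b = upd (upd f s b) t a.
Proof.
move=> ts; apply/funext => r; rewrite /upd.
by case: (eqVneq r s) => [->|//]; rewrite eq_sym (negPf ts).
Qed.

Lemma upd_upd t a b f : upd (upd f t a) t b = upd f t b.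
Proof. by apply/funext => r; rewrite /upd; case: eqP. Qed.

Lemma vacuous_upd S t a f : t \in S -> vacuous_off S f -> vacuous_off S (upd f t a).
Proof.
move=> tS fS s sS; rewrite /upd; case: eqP sS => [->|_]; first by rewrite tS.
exact: fS.
Qed.

Lemma fill_out z s : s \notin domf z -> fill z s = theta s.
Proof. by move=> sz; rewrite /fill not_fnd. Qed.

Lemma fill_cat z z' s :
  fill (z + z')%fset s = if s \in domf z' then fill z' s else fill z s.
Proof. by rewrite /fill fnd_cat; case: ifP. Qed.

Lemma fill_site t a : fill (site t a) = upd theta t a.
Proof.
by apply/funext => s; rewrite /fill /site fnd_set /upd fnd_fmap0; case: eqP.
Qed.

Lemma fill_nil : fill [fmap] = theta.
Proof. by apply/funext => s; rewrite /fill fnd_fmap0. Qed.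

Lemma fill_ffun (J : {fset lattice d}) (y : {ffun J -> X}) (s : J) :
  fill (FinMap y) (val s) = y s.
Proof. by rewrite /fill -[_.[? _]](Some_fnd (f := FinMap y)). Qed.

Lemma fill_trace J f : vacuous_off J f -> fill (FinMap (trace J f)) = f.
Proof.
move=> fJ; apply/funext => s; case: (boolP (s \in J)) => sJ; last first.
  by rewrite fill_out // fJ.
by rewrite -[s]/(val [` sJ]) fill_ffun ffunE.
Qed.

Lemma trace_fill J (y : {ffun J -> X}) : trace J (fill (FinMap y)) = y.
Proof. by apply/ffunP => s; rewrite ffunE fill_ffun. Qed.

Lemma restrE J z : restr theta J z = trace J (fill z).
Proof. by []. Qed.

Lemma agree_site t a f : agree (site t a) f = (f t == a).
Proof.
have e : (site t a).[? t] = Some a by rewrite fnd_set eqxx.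
have st : t \in domf (site t a) by rewrite -fndSome e.
apply/forallP/eqP => [/(_ [` st])|fa s].
  by move/eqP => /= ->; move: e; rewrite (in_fnd st) => -[].
have : val s \in domf (site t a) by apply: valP.
rewrite !inE orbF => /eqP sv; rewrite sv fa.
by have := Some_fnd s; rewrite sv e => -[->].
Qed.

Lemma agree_ffun (J : {fset lattice d}) (y : {ffun J -> X}) f :
  agree (FinMap y) f = (y == trace J f).
Proof.
apply/forallP/eqP => /= [yf|-> s]; last by rewrite ffunE.
by apply/ffunP => s; rewrite ffunE (eqP (yf s)).
Qed.

Lemma agreeP z f :
  reflect (forall s, s \in domf z -> z.[? s] = Some (f s)) (agree z f).
Proof.
apply: (iffP forallP) => [zf s sz|zf s].
  by rewrite (in_fnd sz) (eqP (zf [` sz])).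
by have := zf (val s) (valP s); rewrite -Some_fnd => -[->].
Qed.

Lemma agree_fillP z f :
  reflect (forall s, s \in domf z -> f s = fill z s) (agree z f).
Proof.
apply: (iffP (agreeP z f)) => zf s sz; first by rewrite /fill zf.
by rewrite zf // /fill; case: fndP sz.
Qed.

Lemma agree_cat z z' f : [disjoint domf z & domf z']%fset ->
  agree (z + z')%fset f = agree z f && agree z' f.
Proof.
move=> /fdisjointP dzz'; apply/agreeP/andP => [zf|[/agreeP zf /agreeP zf'] s].
  split; apply/agreeP => s sz; rewrite -zf ?fnd_cat ?mem_catf ?sz ?orbT //.
  by rewrite (negPf (dzz' s sz)).
rewrite mem_catf fnd_cat => /orP[sz|sz]; last by rewrite sz zf'.
by rewrite (negPf (dzz' s sz)) zf.
Qed.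

End Configurations.

(** * Energies and the exchange identity *)

Section Energies.
Variables (R : realType) (d : nat) (X : finType).
Variables (theta : lattice d -> X) (delta : one_point_energies R d X).
Hypothesis hdelta : is_one_point_field delta.
Implicit Types (J S Lam : {fset lattice d}) (f : lattice d -> X).
Implicit Types (t s : lattice d) (z : {fmap lattice d -> X}).

(** The energy cost of changing the spin [a] at [t] into [b], the other spins
    being those of [f]; the value of [f] at [t] does not matter. *)
Definition flip t f (a b : X) : R := delta t (off t f) a b.

Lemma flip_upd t a f : flip t (upd f t a) = flip t f.
Proof. by rewrite /flip upd_off. Qed.

Lemma flip_cocycle t f a b c : flip t f a b = flip t f a c + flip t f c b.
Proof.
apply: (proj1 hdelta) => s; rewrite /off inE.
by case: eqP.
Qed.

(** Both sides are the cost of changing [(a, b)] into [(a', b')] at the sites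
    [t] and [s], changing [t] first on the left and [s] first on the right. *)
Lemma flip_exchange t s f a a' b b' : t != s ->
  flip t (upd f s b) a a' + flip s (upd f t a') b b'
  = flip s (upd f t a) b b' + flip t (upd f s b') a a'.
Proof.
move=> ts; pose xbar : pconfig d X :=
  fun r => if r \in [fset t; s]%fset then None else Some (f r).
have xbarP : config_off [fset t; s] xbar by move=> r; rewrite /xbar; case: ifP.
have offE r r' c : [fset r; r']%fset = [fset t; s]%fset -> r != r' ->
    off r (upd f r' c) = concat xbar (site r' c).
  move=> e rr'; apply/funext => q.
  rewrite /off /concat /site fnd_set fnd_fmap0 /upd /xbar -e !inE.
  by case: (eqVneq q r) => [->|_] /=; [rewrite (negPf rr') | case: ifP].
have stE : [fset s; t] = [fset t; s] by rewrite fsetUC.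
have st : s != t by rewrite eq_sym.
rewrite /flip (offE t s b) // (offE t s b') // (offE s t a) // (offE s t a') //.
exact: (proj2 hdelta).
Qed.

Lemma vac_deltaE t z a b : t \notin domf z ->
  vac_delta theta delta t z a b = flip t (fill theta z) a b.
Proof.
move=> tz; congr delta; apply/funext => s.
rewrite /concat /off /fill /vacuum_off !inE.
case: (eqVneq s t) => [->|st]; first by rewrite not_fnd.
by case: fndP => //= _; case: ifP.
Qed.

(** The cost of replacing the values of [f] by the vacuum, site by site in the
    order of the list. *)
Fixpoint relax (r : seq (lattice d)) f : R :=
  if r is t :: r' then flip t f (f t) (theta t) + relax r' (upd f t (theta t))
  else 0.

(** Moving the step at [t] to the front of the list: each transposition of [t]
    with its predecessor is an instance of the exchange identity. *)
Lemma relax_diff (r : seq (lattice d)) t f b : t \in r ->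
  relax r f - relax r (upd f t b) = flip t f (f t) b.
Proof.
elim: r f => // q r IH f; rewrite inE /=.
case: (eqVneq t q) => [-> _|tq /= tr].
  rewrite upd_upd flip_upd [upd f q b q]/upd eqxx.
  rewrite (flip_cocycle q f (f q) (theta q) b).
  lra.
have {IH tr} := IH (upd f q (theta q)) tr.
rewrite [upd f t b q]/upd eq_sym (negPf tq) [upd f q _ t]/upd (negPf tq).
rewrite -(updC _ _ _ tq).
have := flip_exchange f (f t) b (f q) (theta q) tq.
rewrite !upd_id; lra.
Qed.

Lemma relaxE (r : seq (lattice d)) f : uniq r ->
  relax r f
  = \sum_(t <- r)
      flip t (fun s => if (index s r < index t r)%N then theta s else f s)
        (f t) (theta t).
Proof.
elim: r f => [|q r IH] f /=; first by rewrite big_nil.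
move=> /andP[qr ur]; rewrite big_cons eqxx; congr (_ + _).
rewrite IH // big_seq [RHS]big_seq; apply: eq_bigr => t tr.
have tq : t != q by apply: contraNneq qr => <-.
rewrite (eq_sym q) (negPf tq) {2}/upd (negPf tq); congr flip.
apply/funext => s; rewrite /upd (eq_sym q); case: (eqVneq s q) => [->|_].
  by rewrite if_same.
by rewrite ltnS.
Qed.

(** The enumeration of [Lam] by [enum_rank] is its order as a list. *)
Lemma vac_field_energyE Lam (w : {ffun Lam -> X}) :
  vac_field_energy theta delta w = relax Lam (fill theta (FinMap w)).
Proof.
have idx (s : Lam) : index (val s) Lam = enum_rank s.
  rewrite enum_fsetE index_map; last exact: val_inj.
  rewrite -{1}(enum_rankK s) /enum_val index_uniq ?enum_uniq //.
  by rewrite -cardE.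
rewrite relaxE ?fset_uniq // big_seq_fsetE; apply: eq_bigr => t _.
rewrite fill_ffun ffunE /flip; congr delta; apply/funext => s.
rewrite /concat /off /vacuum_off fnd_cat !fnd_restrict.
case: (boolP (s \in Lam)) => sL; last first.
  rewrite fill_out // if_same !not_fnd // !if_same.
  by case: eqVneq => // st; rewrite st (valP t) in sL.
rewrite -[s]/(val [` sL]%fset) !idx.
move: [` sL]%fset => {sL}s.
have fndE (y : {ffun Lam -> X}) : (FinMap y).[? val s] = Some (y s).
  exact: (esym (Some_fnd (f := FinMap y) s)).
rewrite fill_ffun !inE !fndE ffunE (valP s : val s \in mem_fin _) /= val_eqE.
case: ltngtP => [st|ts|/val_inj/enum_rank_inj ->]; last by rewrite eqxx.
  by case: eqVneq st => [->|//]; rewrite ltnn.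
by case: eqVneq ts => [->|//]; rewrite ltnn.
Qed.

Definition energy Lam f : R := relax Lam f.

Lemma energy_diff Lam t f b : t \in Lam ->
  energy Lam f = flip t f (f t) b + energy Lam (upd f t b).
Proof. by move=> tL; rewrite -(relax_diff f b tL) subrK. Qed.

(** * Correlation functions as cylinder weights *)

Definition weight Lam (P : pred (lattice d -> X)) : R :=
  \sum_(w : {ffun Lam -> X} | P (fill theta (FinMap w)))
     expR (energy Lam (fill theta (FinMap w))).

Lemma partition_functionE Lam :
  partition_function theta delta Lam = weight Lam predT.
Proof. by apply: eq_bigr => w _; rewrite vac_field_energyE. Qed.

Lemma partition_function_gt0 Lam : 0 < partition_function theta delta Lam.
Proof.
rewrite /partition_function (bigD1 [ffun s : Lam => theta (val s)]) //=.
rewrite ltr_wpDr ?expR_gt0 // sumr_ge0 // => w _; exact: expR_ge0.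
Qed.

(** Includes the empty configuration: its cylinder is the whole space, so the
    convention that [rho] is 1 there agrees with the formula. *)
Lemma rhoE Lam z : domf z `<=` Lam ->
  rho theta delta Lam z
  = (partition_function theta delta Lam)^-1 * weight Lam (agree z).
Proof.
move=> zL; rewrite /rho; case: eqP => [z0|_].
  rewrite (_ : agree z = predT) -?partition_functionE; last first.
    by apply/funext => f; apply/(agree_fillP theta) => s; rewrite z0.
  by rewrite mulVf // gt_eqF ?partition_function_gt0.
rewrite zL; congr (_ * _); symmetry.
(* Gluing with [z] is a bijection from the configurations on the rest of [Lam]
   onto the cylinder of [z]. *)
pose glue (y : {ffun (Lam `\` domf z)%fset -> X}) : {ffun Lam -> X} :=
  restr theta Lam (z + FinMap y)%fset.
have fill_glue y : fill theta (FinMap (glue y)) = fill theta (z + FinMap y)%fset.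
  apply: fill_trace => s sL; apply: fill_out; rewrite mem_catf negb_or.
  by rewrite (contra (fsubsetP zL s)) //= in_fsetD negb_and sL orbT.
rewrite /weight (reindex_onto glue
  (fun w => trace (Lam `\` domf z) (fill theta (FinMap w)))) /=.
  apply: eq_big => [y|y _]; last by rewrite vac_field_energyE.
  rewrite fill_glue; apply/andP; split.
    apply/(agree_fillP theta) => s sz; rewrite fill_cat inE sz //.
  apply/eqP/ffunP => s; rewrite ffunE fill_cat (valP s).
  by rewrite -[in RHS](trace_fill theta y) ffunE.
move=> w /(agree_fillP theta) zw; rewrite -[RHS](trace_fill theta w) /glue restrE.
congr trace; apply/funext => s; rewrite fill_cat inE.
case: (boolP (s \in domf z)) => [/zw ->//|sz] /=.
case: (boolP (s \in Lam)) => sL; last by rewrite !fill_out.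
have sLz : s \in (Lam `\` domf z)%fset by rewrite inE sz.
by rewrite -[s]/(val [` sLz]%fset) fill_ffun ffunE.
Qed.

Lemma weight_split Lam (P : pred (lattice d -> X)) t :
  weight Lam P = \sum_(a : X) weight Lam (fun f => P f && (f t == a)).
Proof.
rewrite /weight (partition_big (fun w => fill theta (FinMap w) t) predT) //=.
Qed.

Lemma rho_site Lam t z a : domf z `<=` Lam -> t \in Lam -> t \notin domf z ->
  rho theta delta Lam (site t a + z)%fset
  = (partition_function theta delta Lam)^-1
    * weight Lam (fun f => agree z f && (f t == a)).
Proof.
move=> zL tL tz; rewrite rhoE; last first.
  apply/fsubsetP => s; rewrite !inE orbF => /orP[/eqP -> //|].
  exact: (fsubsetP zL).
congr (_ * weight _ _); apply/funext => f; rewrite agree_cat.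
  by rewrite agree_site andbC.
by apply/fdisjointP => s; rewrite !inE orbF => /eqP ->.
Qed.

(** The cylinder of [z] is the disjoint union, over [a], of those of [z] with
    [a] added at [t]; all but the one with the vacuum are subtracted. *)
Lemma rho_vacuum_at Lam t z : domf z `<=` Lam -> t \in Lam -> t \notin domf z ->
  rho theta delta Lam z
    - \sum_(a : X | a != theta t) rho theta delta Lam (site t a + z)%fset
  = (partition_function theta delta Lam)^-1
    * weight Lam (fun f => agree z f && (f t == theta t)).
Proof.
move=> zL tL tz; rewrite rhoE // (weight_split _ _ t) (bigD1 (theta t)) //=.
rewrite mulrDr -addrA [X in _ + (X - _)]mulr_sumr -sumrB big1 ?addr0 // => a _.
by rewrite rho_site // subrr.
Qed.

(** * Pair couplings and the expansion of G *)

(** The pair interaction between the spins [a] at [t] and [b] at [s], in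
    vacuum; its definition from the side of [t] hides its symmetry. *)
Definition coupling t a s b : R :=
  flip t (upd theta s b) a (theta t) - flip t theta a (theta t).

Lemma coupling_vacuum t a s : coupling t a s (theta s) = 0.
Proof. by rewrite /coupling upd_id subrr. Qed.

Lemma couplingC t a s b : t != s -> coupling t a s b = coupling s b t a.
Proof.
move=> ts; have := flip_exchange theta a (theta t) b (theta s) ts.
rewrite /coupling !upd_id; lra.
Qed.

Lemma KfunE t J a (y : {ffun J -> X}) : t \notin J ->
  Kfun theta delta t a y = \prod_(s : J) (expR (coupling t a (val s) (y s)) - 1).
Proof.
move=> tJ; apply: eq_bigr => s _.
have st : t != val s by apply: contraNneq tJ => ->; apply: valP.
rewrite couplingC // !vac_deltaE ?fill_site ?fill_nil //.
by rewrite !inE orbF eq_sym.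
Qed.

(** For given J the only y that [f] extends is its trace on J.  If that trace
    takes a vacuum value, no y is summed, and the product vanishes too because
    [coupling_vacuum] makes a factor 0; so the restriction to nonvacuum y can
    be dropped and the powerset expansion applies. *)
Lemma sum_Kfun t a S f : t \notin S ->
  \sum_(J <- fpowerset S)
    \sum_(y : {ffun J -> X} | nonvacuum theta y && agree (FinMap y) f)
      Kfun theta delta t a y
  = \prod_(s <- S) expR (coupling t a s (f s)).
Proof.
move=> tS; pose g s := expR (coupling t a s (f s)) - 1.
transitivity (\sum_(J <- fpowerset S) \prod_(s <- J) g s); last first.
  by rewrite sum_fpowerset_prod; apply: eq_bigr => s _; rewrite subrK.
rewrite big_seq [RHS]big_seq; apply: eq_bigr => J.
rewrite fpowersetE => JS.
have tJ : t \notin J by apply: contra tS; exact: (fsubsetP JS).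
have KE : Kfun theta delta t a (trace J f) = \prod_(s <- J) g s.
  by rewrite KfunE // big_seq_fsetE; apply: eq_bigr => s _; rewrite ffunE.
rewrite -KE; case: (boolP (nonvacuum theta (trace J f))) => vf.
  rewrite (big_pred1 (trace J f)) // => y; rewrite agree_ffun.
  by apply/andP/eqP => [[_ /eqP]//|->].
rewrite big1 => [|y]; last first.
  by rewrite agree_ffun => /andP[vy /eqP e]; rewrite -e vy in vf.
move: vf; rewrite negb_forall => /existsP[s]; rewrite negbK ffunE => /eqP fs.
rewrite KE big_seq_fsetE (bigD1 s) //= /g fs coupling_vacuum expR0 subrr.
by rewrite mul0r.
Qed.

(** The configurations of the weights in [Gfun] extend [u] and y with vacuum
    at [t]; summing over y and J first leaves a product for each of them. *)
Lemma GfunE Lam I t a (u : {ffun (I `\ t) -> X}) : I `<=` Lam -> t \in I ->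
  Gfun theta delta Lam I t a (FinMap u)
  = (partition_function theta delta Lam)^-1
    * \sum_(w : {ffun Lam -> X} | agree (FinMap u) (fill theta (FinMap w))
                                  && (fill theta (FinMap w) t == theta t))
        expR (energy Lam (fill theta (FinMap w)))
        * \prod_(s <- Lam `\` I)
            expR (coupling t a s (fill theta (FinMap w) s)).
Proof.
move=> IL tI; have tL := fsubsetP IL t tI.
have tLI : t \notin (Lam `\` I)%fset by rewrite inE tI.
under eq_bigr => w _ do rewrite -(sum_Kfun a _ tLI).
under eq_bigr => w _ do rewrite mulr_sumr.
rewrite exchange_big /= mulr_sumr /Gfun big_seq [RHS]big_seq.
apply: eq_bigr => J; rewrite fpowersetE => JLI.
have tJ : t \notin J by apply: contra tLI; exact: (fsubsetP JLI).
(* The condition that [w] extends y passes from the sum over y to the sum over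
   [w]: together with the vacuum at [t] it is the event of [rho_vacuum_at]. *)
under [in RHS]eq_bigr => w _ do rewrite mulr_sumr big_mkcondr /=.
rewrite exchange_big /= mulr_sumr; apply: eq_bigr => y _.
under [X in _ - X]eq_bigr => b _ do rewrite -catfA.
rewrite rho_vacuum_at //; first last.
- by rewrite !inE eqxx (negPf tJ).
- apply/fsubsetP => s; rewrite mem_catf /= !inE => /orP[/andP[_ /(fsubsetP IL)]//|].
  by move=> /(fsubsetP JLI); rewrite inE => /andP[].
rewrite mulrCA; congr (_ * _); rewrite -big_mkcondr /= mulr_sumr.
apply: eq_big => [w|w _]; last by rewrite mulrC.
rewrite agree_cat; first by rewrite andbAC.
apply/fdisjointP => s /=; rewrite !inE => /andP[_ sI].
by apply: contraL sI => /(fsubsetP JLI); rewrite inE => /andP[].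
Qed.

(** * Factorisation of the weights *)

Definition clear S f : lattice d -> X :=
  fun s => if s \in S then theta s else f s.

(** Changing the spin at [t] is a bijection between the two cylinders. *)
Lemma weight_upd Lam t a z (F : (lattice d -> X) -> R) :
  t \in Lam -> t \notin domf z ->
  \sum_(w : {ffun Lam -> X} | agree z (fill theta (FinMap w))
                              && (fill theta (FinMap w) t == a))
    F (fill theta (FinMap w))
  = \sum_(w : {ffun Lam -> X} | agree z (fill theta (FinMap w))
                                && (fill theta (FinMap w) t == theta t))
      F (upd (fill theta (FinMap w)) t a).
Proof.
move=> tL tz; pose move b (w : {ffun Lam -> X}) :=
  trace Lam (upd (fill theta (FinMap w)) t b).
have fillM b w : fill theta (FinMap (move b w)) = upd (fill theta (FinMap w)) t b.
  by apply/fill_trace/vacuous_upd => // s sL; rewrite fill_out.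
have agreeM b f : agree z (upd f t b) = agree z f.
  apply/agreeP/agreeP => zf s sz; rewrite zf // /upd;
    by case: eqP sz => // ->; rewrite (negPf tz).
rewrite (reindex_onto (move a) (move (theta t))) /=; last first.
  move=> w /andP[_ /eqP wt]; rewrite /move fillM upd_upd -wt upd_id.
  exact: trace_fill.
apply: eq_big => [w|w _]; last by rewrite fillM.
rewrite fillM agreeM [upd _ _ _ t]/upd !eqxx andbT; congr (_ && _).
rewrite {1}/move fillM upd_upd; apply/eqP/eqP => [e|e]; last first.
  by rewrite -e upd_id trace_fill.
rewrite -[w in LHS]e fill_trace ?{1}/upd ?eqxx //.
by apply: vacuous_upd => // s sL; rewrite fill_out.
Qed.

Lemma vac_delta_site t s a b c : t != s ->
  vac_delta theta delta t (site s c) a b = flip t (upd theta s c) a b.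
Proof. by move=> ts; rewrite vac_deltaE ?fill_site // !inE orbF. Qed.

Lemma vac_delta_cat t s I f a b c : t != s -> t \notin I ->
  vacuous_off theta (t |` (s |` I)) f ->
  vac_delta theta delta t (FinMap (trace I f) + site s c)%fset a b
  = flip t (upd f s c) a b.
Proof.
move=> ts tI fI; rewrite vac_deltaE; last first.
  by rewrite mem_catf /= !inE orbF negb_or tI.
congr delta; apply/funext => r; rewrite /off fill_cat !inE orbF fill_site /upd.
case: (eqVneq r t) => // rt; case: (eqVneq r s) => // rs; congr Some.
case: (boolP (r \in I)) => rI.
  by rewrite -[r]/(val [` rI]%fset) fill_ffun ffunE.
by rewrite fill_out // fI // !inE !negb_or rt rs.
Qed.

Hypothesis hcond : forall Lam : {fset lattice d}, Lam != fset0 ->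
  forall t s : lattice d, t \in Lam -> s \in Lam -> t != s ->
  forall I : {fset lattice d}, I `<=` Lam `\` [fset t; s] ->
  forall (x y v : X) (z : {ffun I -> X}),
    vac_delta theta delta t (FinMap z + site s y)%fset x (theta t)
      - vac_delta theta delta t (FinMap z + site s v)%fset x (theta t)
    = vac_delta theta delta t (site s y) x (theta t)
      - vac_delta theta delta t (site s v) x (theta t).

(** The additivity hypothesis, for a configuration [f] that is the vacuum
    outside a finite set: the effect of the spin at [s] on the cost at [t] does
    not depend on the other spins. *)
Lemma flip_two_site Lam t s f a b : t != s -> vacuous_off theta Lam f ->
  flip t f a (theta t) - flip t (upd f s b) a (theta t)
  = coupling t a s (f s) - coupling t a s b.
Proof.
(* Enlarging [Lam] costs nothing and makes room for [t] and [s]. *)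
move=> ts fL; pose Lam' := [fset t; s] `|` Lam; pose I := Lam' `\` [fset t; s].
have tL' : t \in Lam' by rewrite !inE eqxx.
have sL' : s \in Lam' by rewrite !inE eqxx orbT.
have L'0 : Lam' != fset0 by apply/fset0Pn; exists t.
have fI : vacuous_off theta (t |` (s |` I)) f.
  move=> r rI; apply: fL; apply: contra rI => rL; rewrite /I /Lam' !inE rL.
  by case: (r == t); case: (r == s).
have tI : t \notin I by rewrite !inE eqxx.
have h := hcond L'0 tL' sL' ts (fsubset_refl I) a (f s) b (trace I f).
rewrite -[in LHS](upd_id s f) upd_upd.
transitivity (flip t (upd theta s (f s)) a (theta t)
              - flip t (upd theta s b) a (theta t)); last first.
  by rewrite /coupling opprB addrA subrK.
apply: etrans (etrans _ h) _; congr (_ - _);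
  by [exact: vac_delta_site | symmetry; exact: vac_delta_cat].
Qed.

(** Clearing one more site of [S] removes exactly its coupling with [t]. *)
Lemma flip_clear Lam t S f a : t \notin S -> vacuous_off theta Lam f ->
  flip t f a (theta t)
  = flip t (clear S f) a (theta t) + \sum_(s <- S) coupling t a s (f s).
Proof.
move=> + fL; elim/fset1U_rect: S => [|s S sS IH] tS.
  rewrite big_seq_fset0 addr0; congr flip.
move: tS; rewrite !inE negb_or => /andP[ts tS].
have cL : vacuous_off theta Lam (clear S f).
  by move=> r rL; rewrite /clear fL // if_same.
have e : clear (s |` S) f = upd (clear S f) s (theta s).
  by apply/funext => r; rewrite /clear /upd !inE; case: eqVneq => [->|].
have := flip_two_site a (theta s) ts cL.
rewrite IH // e big_fsetU1 //= coupling_vacuum [clear S f s]/clear (negPf sS).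
lra.
Qed.

(** Once the sites of [Lam] outside [I] are cleared, [f] and [u] with vacuum
    elsewhere coincide off [t]. *)
Lemma energy_upd Lam I t a (u : {ffun (I `\ t) -> X}) f :
  I `<=` Lam -> t \in I -> vacuous_off theta Lam f ->
  agree (FinMap u) f -> f t = theta t ->
  energy Lam (upd f t a)
  = vac_delta theta delta t (FinMap u) a (theta t)
    + energy Lam f + \sum_(s <- Lam `\` I) coupling t a s (f s).
Proof.
move=> IL tI fL uf ft; have tL := fsubsetP IL t tI.
rewrite (energy_diff (upd f t a) (theta t) tL) upd_upd flip_upd.
rewrite -{2}ft upd_id [upd _ _ _ t]/upd eqxx addrAC; congr (_ + _).
have tLI : t \notin (Lam `\` I)%fset by rewrite inE tI.
rewrite (flip_clear a tLI fL) vac_deltaE; last by rewrite !inE eqxx.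
congr (_ + _); congr delta; apply/funext => s; rewrite /off /clear !inE.
case: (eqVneq s t) => // st; congr Some.
case: (boolP (s \in I)) => sI /=.
  by rewrite (agree_fillP theta _ _ uf) // !inE st.
rewrite [RHS]fill_out; last by rewrite !inE negb_and sI orbT.
by case: ifP => // /negbT; exact: fL.
Qed.

(** Holds also for [a = theta t], where [Gfun] is the normalised weight of the
    configurations with vacuum at [t] and the exponential is 1; this is what allows summing over all
    [a] to recover [rho u]. *)
Lemma weight_Gfun Lam I t a (u : {ffun (I `\ t) -> X}) :
  I `<=` Lam -> t \in I ->
  (partition_function theta delta Lam)^-1
    * weight Lam (fun f => agree (FinMap u) f && (f t == a))
  = expR (vac_delta theta delta t (FinMap u) a (theta t))
    * Gfun theta delta Lam I t a (FinMap u).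
Proof.
move=> IL tI; have tL := fsubsetP IL t tI.
rewrite GfunE // mulrCA; congr (_ * _); rewrite /weight.
rewrite (weight_upd a (fun f => expR (energy Lam f))) //; last by rewrite !inE eqxx.
rewrite mulr_sumr; apply: eq_bigr => w /andP[uw /eqP wt].
rewrite (energy_upd a IL tI _ uw wt); last by move=> s sL; rewrite fill_out.
by rewrite -expR_sum -addrA !expRD.
Qed.

End Energies.

Theorem theorem2 (R : realType) (d : nat) (hd : (0 < d)%N)
    (X : finType) (hX : (1 < #|X|)%N)
    (theta : lattice d -> X) (delta : one_point_energies R d X)
    (hdelta : is_one_point_field delta)
    (hcond : forall Lam : {fset lattice d}, Lam != fset0 ->
       forall t s : lattice d, t \in Lam -> s \in Lam -> t != s ->
       forall I : {fset lattice d}, I `<=` Lam `\` [fset t; s] ->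
       forall (x y v : X) (z : {ffun I -> X}),
         vac_delta theta delta t (FinMap z + site s y)%fset x (theta t)
           - vac_delta theta delta t (FinMap z + site s v)%fset x (theta t)
         = vac_delta theta delta t (site s y) x (theta t)
           - vac_delta theta delta t (site s v) x (theta t)) :
  forall Lam : {fset lattice d}, Lam != fset0 ->
  forall I : {fset lattice d}, I `<=` Lam ->
  forall t : lattice d, t \in I ->
  forall (x : X) (u : {ffun (I `\ t) -> X}),
    x != theta t -> nonvacuum theta u ->
    let E (alpha : X) := expR (vac_delta theta delta t (FinMap u) alpha (theta t)) in
    rho theta delta Lam (site t x + FinMap u)%fset
    = E x / (\sum_(alpha : X) E alpha)
      * (rho theta delta Lam (FinMap u)
         + \sum_(alpha : X)
             E alpha * (Gfun theta delta Lam I t x (FinMap u)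
                        - Gfun theta delta Lam I t alpha (FinMap u))).
Proof.
move=> Lam _ I IL t tI x u _ _ E.
pose G a := Gfun theta delta Lam I t a (FinMap u).
have tL := fsubsetP IL t tI.
have uL : domf (FinMap u) `<=` Lam.
  exact: fsubset_trans (fsubsetDl _ _) IL.
have tu : t \notin domf (FinMap u) by rewrite !inE eqxx.
have EG a := weight_Gfun hdelta hcond a u IL tI.
have rho_u : rho theta delta Lam (FinMap u) = \sum_(a : X) E a * G a.
  rewrite rhoE // (weight_split _ _ _ _ t) mulr_sumr.
  by apply: eq_bigr => a _; exact: EG.
rewrite rho_site // EG rho_u -/(G x) weighted_mean_correction // gt_eqF //.
rewrite (bigD1 x) //= ltr_wpDr ?expR_gt0 // sumr_ge0 // => a _.
exact: expR_ge0.
Qed.
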